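(* Let $\mathsf{V}_o$ be a finite set of vertices, let $\mathsf{U}_o$ be the finite-dimensional real vector space of functions $\mathsf{V}_o\to\mathbb{R}^{d_u}$, let $\mathsf{Z}=\mathbb{R}^{d_z}$, and let $D_o^\psi:\mathsf{Z}\to\mathsf{U}_o$ be a (Borel) measurable map. Let $q_{\mathbf{z}}=\mathcal{N}(\mathbf{0},\mathbf{I})$ be the standard Gaussian on $\mathsf{Z}$, let $\mathbf{H}_o:\mathsf{U}_o\to\mathbb{R}^{d_o}$ be the linear observation operator (a matrix of zeros and ones selecting the observed nodal values), let $\sigma>0$, and let $\mathbf{y}_o\in\mathbb{R}^{d_o}$. Let $p^\psi_{\mathbf{u}_o|\mathbf{y}_o}$ be the Bayesian posterior on $\mathsf{U}_o$ with prior $p^\psi_{\mathbf{u}_o}:=D^\psi_{o\,\#}q_{\mathbf{z}}$ for the observation model $\mathbf{y}_o=\mathbf{H}_o\mathbf{u}_o+\boldsymbol{\xi}_o$, $\boldsymbol{\xi}_o\sim\mathcal{N}(\mathbf{0},\sigma^2\mathbf{I}_o)$ (with noise independent of $\mathbf{u}_o$). Let $p^\psi_{\mathbf{z}|\mathbf{y}_o}$ be the latent posterior on $\mathsf{Z}$ with prior $q_{\mathbf{z}}$ and likelihood $p^\psi_{\mathbf{y}_o|\mathbf{z}}=\mathcal{N}(\mathbf{H}_oD^\psi_o(\mathbf{z}),\sigma^2\mathbf{I}_o)$, that is, $$p^\psi_{\mathbf{z}|\mathbf{y}_o}(\mathbf{z})=\frac{p^\psi_{\mathbf{y}_o|\mathbf{z}}(\mathbf{y}_o)\,q_{\mathbf{z}}(\mathbf{z})}{p_{\mathbf{y}_o}(\mathbf{y}_o)},$$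 where $p_{\mathbf{y}_o}(\mathbf{y}_o)$ is the normalizing constant. Then $$p^\psi_{\mathbf{u}_o|\mathbf{y}_o}=D^\psi_{o\,\#}\,p^\psi_{\mathbf{z}|\mathbf{y}_o}.$$
   Context: In the paper's setting, $D_o^\psi=D^\psi(\cdot\,;\mathsf{M}_o)$ is a graph-neural-network decoder with parameters $\psi$ conditioned on a mesh (undirected graph) $\mathsf{M}_o$ with vertex set $\mathsf{V}_o$; for the statement it is just a fixed measurable map. $\mathbf{I}_o$ is the $d_o\times d_o$ identity matrix. For a measurable map $g$ and a measure $\mathbb{P}$, the pushforward is $(g_{\#}\mathbb{P})(A)=\mathbb{P}(g^{-1}(A))$ for measurable $A$. The letters $p,q$ denote probability measures as well as their Lebesgue densities when these exist (the prior $p^\psi_{\mathbf{u}_o}$ need not have a density); the asserted identity is an equality of probability measures on $\mathsf{U}_o$. The Bayesian posterior for a prior probability measure $\mathbb{P}$ on a space $\mathcal{X}$ and a likelihood density $x\mapsto p(\mathbf{y}_o|x)$ is the probability measure $A\mapsto \frac{\int_A p(\mathbf{y}_o|x)\,\mathrm{d}\mathbb{P}(x)}{\int_{\mathcal{X}} p(\mathbf{y}_o|x)\,\mathrm{d}\mathbb{P}(x)}$. For the posterior on $\mathsf{U}_o$ the likelihood at $\mathbf{u}$ is the density of $\mathcal{N}(\mathbf{H}_o\mathbf{u},\sigma^2\mathbf{I}_o)$ evaluated at $\mathbf{y}_o$. *)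

(* Defs.v *)
From HB Require Import structures.
From mathcomp Require Import all_boot all_order all_algebra.
From mathcomp Require Import all_classical all_reals all_analysis.
From mathcomp Require Import measurable_realfun.

Set Implicit Arguments.
Unset Strict Implicit.
Unset Printing Implicit Defensive.

Import Order.TTheory GRing.Theory Num.Theory.
Import numFieldNormedType.Exports.

Local Open Scope classical_set_scope.
Local Open Scope ring_scope.

(* [T] itself, with the sigma-algebra generated by its open sets. *)
Notation borel T := (g_sigma_algebraType (@open T)).

Lemma borel_continuous (S T : ptopologicalType) (f : S -> T) :
  continuous f -> measurable_fun setT (f : borel S -> borel T).
Proof.
move=> /continuousP cf.
apply: (@measurability _ _ (borel S) (borel T) setT f (@open T)) => // _ [A oA <-].
by rewrite setTI; apply: sub_sigma_algebra; exact: cf.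
Qed.

Lemma borel_continuousR (R : realType) (S : ptopologicalType) (f : S -> R) :
  continuous f -> measurable_fun setT (f : borel S -> R).
Proof.
move=> /continuousP cf.
apply: (measurability _ (RGenOpens.measurableE R)) => _ [_ [a [b ->] <-]].
by rewrite setTI; apply: sub_sigma_algebra; apply: cf; exact: interval_open.
Qed.

Lemma borel_rV d (T : measurableType d) (R : realType) n (f : T -> 'rV[R]_n) :
  (forall i, measurable_fun setT (fun x => f x ord0 i)) ->
  measurable_fun setT (f : T -> borel 'rV[R]_n).
Proof.
move=> mf.
apply: (@measurability _ _ T (borel 'rV[R]_n) setT f (@open 'rV[R]_n)) => // _ [A oA <-].
rewrite setTI.
pose I := [set qk : 'rV[rat]_n * nat |
  ball (map_mx ratr qk.1 : 'rV[R]_n) (qk.2.+1%:R^-1 : R) `<=` A].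
have -> : f @^-1` A = \bigcup_(qk in I) \bigcap_(i in [set: 'I_n])
    (fun x => f x ord0 i) @^-1` (ball (ratr (qk.1 ord0 i) : R) (qk.2.+1%:R^-1 : R)).
  apply/seteqP; split=> [x Afx|x [[q k] /= qkA bx]]; last first.
    apply: qkA; split=> [|i j]; first by rewrite invr_gt0.
    by rewrite ord1 mxE; exact: bx.
  have /nbhs_ballP[e /= e0 eA] : nbhs (f x) A by exact: open_nbhs_nbhs.
  pose k := Num.truncn (2 / e).
  have ke : k.+1%:R^-1 < e / 2.
    by rewrite -[e / 2]invrK ltf_pV2 ?posrE ?invr_gt0 ?divr_gt0// invf_div truncnS_gt.
  have /choice[q qE] (i : 'I_n) : exists q : rat, `|ratr q - f x ord0 i| < (k.+1%:R^-1 : R).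
    have : f x ord0 i - k.+1%:R^-1 < f x ord0 i + k.+1%:R^-1.
      by rewrite ltrBlDr -addrA ltrDl addr_gt0// invr_gt0.
    move=> /rat_in_itvoo[q]; rewrite in_itv/= => /andP[q1 q2]; exists q.
    by rewrite ltr_distl q1.
  exists (\row_i q i, k) => /=; last first.
    by move=> i _ /=; rewrite mxE; exact: qE.
  move=> v [_ vb]; apply: eA; split=> // i j.
  have := vb i j; rewrite /ball/= !mxE ord1 => qv.
  rewrite distrC (le_lt_trans (ler_distD (ratr (q j)) _ _))//.
  rewrite (splitr e) ltrD//; first by rewrite distrC (lt_trans qv).
  exact: (lt_trans (qE j)).
rewrite bigcup_mkcond; apply: countable_bigcupT_measurable => // -[q k].
case: ifPn => // _; apply: fin_bigcap_measurable => // i _.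
rewrite -[X in measurable X]setTI; apply: mf => //.
exact: measurable_ball.
Qed.

Section lebesgue_rVS.
Context {R : realType} {n : nat}.
Context (mu : {sigma_finite_measure set (borel 'rV[R]_n) -> \bar R}).

Definition cons_rV (p : measurableTypeR R * borel 'rV[R]_n) :
  borel 'rV[R]_n.+1 := row_mx (p.1%:M : 'rV_1) (p.2 : 'rV_n).

Definition uncons_rV (v : borel 'rV[R]_n.+1) :
    measurableTypeR R * borel 'rV[R]_n :=
  ((v : 'rV_n.+1) ord0 ord0, \row_i (v : 'rV_n.+1) ord0 (lift ord0 i)).

Lemma cons_rV0 p : (cons_rV p : 'rV_n.+1) ord0 ord0 = p.1.
Proof.
rewrite [LHS]mxE; case: splitP => [j _|k /= /eqP]; last by rewrite eq_sym addn_eq0.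
by rewrite mxE (ord1 j) mulr1n.
Qed.

Lemma cons_rVS p i : (cons_rV p : 'rV_n.+1) ord0 (lift ord0 i) =
  (p.2 : 'rV_n) ord0 i.
Proof.
rewrite [LHS]mxE; case: splitP => [j|k].
  by rewrite ord1.
by rewrite lift0 add1n => -[/ord_inj ->].
Qed.

Lemma cons_rVK : cancel cons_rV uncons_rV.
Proof.
move=> [x v]; rewrite /uncons_rV cons_rV0; congr pair.
by apply/rowP => i; rewrite mxE cons_rVS.
Qed.

Lemma measurable_cons_rV : measurable_fun setT cons_rV.
Proof.
apply: borel_rV => i; have [j ->|->] := unliftP ord0 i.
  rewrite (_ : (fun _ => _) =
      (fun v : borel 'rV[R]_n => (v : 'rV_n) ord0 j) \o snd).
    apply: measurableT_comp => //.
    by apply: borel_continuousR; exact: coord_continuous.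
  by apply/funext => p; rewrite cons_rVS.
rewrite (_ : (fun _ => _) = fst) //.
by apply/funext => p; rewrite cons_rV0.
Qed.

Lemma measurable_uncons_rV : measurable_fun setT uncons_rV.
Proof.
apply/measurable_fun_pairP; split.
  by apply: borel_continuousR; exact: coord_continuous.
apply: borel_rV => i; rewrite (_ : (fun _ => _) =
    (fun v : 'rV[R]_n.+1 => v ord0 (lift ord0 i))).
  by apply: borel_continuousR; exact: coord_continuous.
by apply/funext => v; rewrite mxE.
Qed.

Definition lebesgue_rVS : set (borel 'rV[R]_n.+1) -> \bar R :=
  pushforward (lebesgue_measure \x mu)%E cons_rV.

HB.instance Definition _ := Measure.copy lebesgue_rVS
  (measure_function_pushforward__canonical__measure_function_Measure
     (lebesgue_measure \x mu)%E measurable_cons_rV).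

Let lebesgue_rVS_sigma_finite : sigma_finite setT lebesgue_rVS.
Proof.
have /sigma_finiteP[F [FT ndF Foo]] := sigma_finiteT (@lebesgue_measure R).
have /sigma_finiteP[G [GT ndG Goo]] := sigma_finiteT mu.
exists (fun k => uncons_rV @^-1` (F k `*` G k)).
  rewrite -preimage_bigcup (_ : \bigcup_k _ = setT) ?preimage_setT//.
  apply/seteqP; split=> // -[x v] _.
  have [i _ Fx] : (\bigcup_i F i) x by rewrite -FT.
  have [j _ Gv] : (\bigcup_i G i) v by rewrite -GT.
  exists (maxn i j) => //; split => /=.
  - by move: x Fx; exact/subsetPset/ndF/leq_maxl.
  - by move: v Gv; exact/subsetPset/ndG/leq_maxr.
move=> k; have [mF Fk] := Foo k; have [mG Gk] := Goo k.
have mFG : measurable (F k `*` G k) by exact: measurableX.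
split.
  by rewrite -[X in measurable X]setTI; exact: measurable_uncons_rV.
rewrite /lebesgue_rVS /pushforward -comp_preimage.
rewrite (_ : uncons_rV \o cons_rV = id); last exact/funext/cons_rVK.
by rewrite preimage_id product_measure1E// lte_mul_pinfty// ge0_fin_numE.
Qed.

HB.instance Definition _ := Measure_isSigmaFinite.Build _ _ _ lebesgue_rVS
  lebesgue_rVS_sigma_finite.

End lebesgue_rVS.

(* Lebesgue measure on R^n, as the n-fold product of the one on R; see
   [lebesgue_rV_box] for its values on boxes.  *)
Fixpoint lebesgue_rV (R : realType) (n : nat) :
    {sigma_finite_measure set (borel 'rV[R]_n) -> \bar R} :=
  match n with
  | 0 => \d_(0 : borel 'rV[R]_0)
  | m.+1 => lebesgue_rVS (lebesgue_rV R m)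
  end.

Lemma lebesgue_rV_box (R : realType) n (A : 'I_n -> set (measurableTypeR R)) :
  (forall i, measurable (A i)) ->
  lebesgue_rV R n [set v : 'rV[R]_n | forall i, A i (v ord0 i)] =
  (\prod_(i < n) lebesgue_measure (A i))%E.
Proof.
elim: n A => [A _|n IHn A mA] /=.
  by rewrite big_ord0 diracE mem_set// => -[].
rewrite big_ord_recl -IHn//.
rewrite -product_measure1E//; last first.
  rewrite (_ : [set _ | _] = \bigcap_(i in [set: 'I_n])
      (fun v : borel 'rV[R]_n => (v : 'rV_n) ord0 i) @^-1` A (lift ord0 i)).
    apply: fin_bigcap_measurable => // i _.
    rewrite -[X in measurable X]setTI.
    have := borel_continuousR (@coord_continuous R 1 n ord0 i).
    by apply; [exact: measurableT|exact: mA].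
  by apply/seteqP; split => v /= Av i; [move=> _|]; exact: Av.
rewrite /lebesgue_rVS /pushforward; congr product_measure1.
apply/seteqP; split=> -[x v] /=.
  move=> Ap; split=> [|i /=]; first by have := Ap ord0; rewrite cons_rV0.
  by have := Ap (lift ord0 i); rewrite cons_rVS.
move=> [Ax Av] i; have [j ->|->] := unliftP ord0 i.
  by rewrite cons_rVS; exact: Av.
by rewrite cons_rV0.
Qed.

(* Density of N(m, S) w.r.t. [lebesgue_rV R n]; vectors are rows, hence the
   position of the transpose in the quadratic form.  *)
Definition gaussian_pdf (R : realType) n (m : 'rV[R]_n) (S : 'M[R]_n)
    (x : 'rV[R]_n) : R :=
  (Num.sqrt ((2 * pi) ^+ n * \det S))^-1 *
  expR (- (((x - m) *m invmx S *m (x - m)^T) ord0 ord0) / 2).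

Section std_gaussian.
Context {R : realType}.

Lemma gaussian_pdf01E n (x : 'rV[R]_n) :
  gaussian_pdf 0 1%:M x = \prod_(i < n) normal_pdf 0 1 (x ord0 i).
Proof.
rewrite /gaussian_pdf det1 mulr1 invmx1 mulmx1 subr0.
under eq_bigr do rewrite normal_pdfE ?oner_neq0//.
rewrite big_split/= prodr_const card_ord; congr (_ * _).
  rewrite /normal_peak expr1n mul1r -[pi *+ 2]mulr_natl exprVn; congr (_^-1).
  elim: n {x} => [|n IHn]; first by rewrite !expr0 sqrtr1.
  rewrite !exprS -IHn -sqrtrM//.
  by rewrite mulr_ge0// pi_ge0.
rewrite -expR_sum; congr expR; rewrite mxE -sumrN mulr_suml.
by apply: eq_bigr => i _; rewrite /normal_fun mxE subr0 expr1n -expr2.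
Qed.

Lemma gaussian_pdf01_ge0 n (x : 'rV[R]_n) : 0 <= gaussian_pdf 0 1%:M x.
Proof.
by rewrite gaussian_pdf01E; apply: prodr_ge0 => i _; exact: normal_pdf_ge0.
Qed.

Lemma measurable_gaussian_pdf01 n :
  measurable_fun setT (gaussian_pdf 0 1%:M : borel 'rV[R]_n -> R).
Proof.
rewrite (_ : gaussian_pdf _ _ = fun x : borel 'rV[R]_n =>
    \prod_(i < n) normal_pdf 0 1 ((x : 'rV_n) ord0 i)); last first.
  by apply/funext => x; rewrite gaussian_pdf01E.
apply: measurable_prod => i _.
apply: (measurableT_comp (measurable_normal_pdf 0 1)).
by apply: borel_continuousR; exact: coord_continuous.
Qed.

Lemma integral_gaussian_pdf01 n :
  (\int[lebesgue_rV R n]_x (gaussian_pdf 0 1%:M (x : 'rV[R]_n))%:E = 1)%E.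
Proof.
elim: n => [|n IHn] /=.
  rewrite integral_dirac//.
  rewrite diracT mul1e gaussian_pdf01E big_ord0//.
  by apply/measurable_EFinP; exact: measurable_gaussian_pdf01.
rewrite ge0_integral_pushforward//=; last 3 first.
- exact: measurable_cons_rV.
- by apply/measurable_EFinP; exact: measurable_gaussian_pdf01.
- by move=> x _; rewrite lee_fin gaussian_pdf01_ge0.
rewrite preimage_setT fubini_tonelli1//=; last 2 first.
- apply/measurable_EFinP.
  exact: (measurableT_comp (@measurable_gaussian_pdf01 n.+1)
    measurable_cons_rV).
- by move=> x; rewrite lee_fin gaussian_pdf01_ge0.
rewrite -[RHS](integral_normal_pdf 0 (1 : R)).
apply: eq_integral => x _; rewrite /fubini_F.
under eq_integral => v _.
  rewrite gaussian_pdf01E big_ord_recl cons_rV0.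
  under eq_bigr do rewrite cons_rVS.
  rewrite -gaussian_pdf01E/= EFinM.
  over.
rewrite ge0_integralZl//= ?IHn ?mule1//.
- by apply/measurable_EFinP; exact: measurable_gaussian_pdf01.
- by move=> v _; rewrite lee_fin gaussian_pdf01_ge0.
- by rewrite lee_fin normal_pdf_ge0.
Qed.

End std_gaussian.

Definition std_gaussian (R : realType) n : set (borel 'rV[R]_n) -> \bar R :=
  fun A => (\int[lebesgue_rV R n]_(x in A)
              (gaussian_pdf 0 1%:M (x : 'rV[R]_n))%:E)%E.

Arguments std_gaussian : clear implicits.

Section std_gaussian_probability.
Context (R : realType) (n : nat).

Let std_gaussian0 : std_gaussian R n set0 = 0%E.
Proof. exact: integral_set0. Qed.

Let std_gaussian_ge0 A : (0 <= std_gaussian R n A)%E.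
Proof.
by apply: integral_ge0 => x _; rewrite lee_fin gaussian_pdf01_ge0.
Qed.

Let std_gaussian_sigma_additive : semi_sigma_additive (std_gaussian R n).
Proof.
move=> /= A mA tA mUA; rewrite /std_gaussian ge0_integral_bigcup//=.
- apply: is_cvg_ereal_nneg_natsum_cond => k _ _; exact: std_gaussian_ge0.
- apply: measurable_funTS; apply/measurable_EFinP.
  exact: measurable_gaussian_pdf01.
- by move=> x _; rewrite lee_fin gaussian_pdf01_ge0.
Qed.

HB.instance Definition _ := isMeasure.Build _ _ _ (std_gaussian R n)
  std_gaussian0 std_gaussian_ge0 std_gaussian_sigma_additive.

Let std_gaussian_setT : std_gaussian R n setT = 1%E.
Proof. exact: integral_gaussian_pdf01. Qed.

HB.instance Definition _ := Measure_isProbability.Build _ _ _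
  (std_gaussian R n) std_gaussian_setT.

End std_gaussian_probability.

(* [H] has a matrix of zeros and ones whose [k]-th row has its only 1 in the
   column [s k], i.e. the [k]-th observation is the [(s k).2]-th component of
   the value at the vertex [(s k).1].  *)
Definition selection_operator (R : realType) (V : finType) (du d : nat)
    (H : (V -> 'rV[R]_du) -> 'rV[R]_d) : Prop :=
  exists s : 'I_d -> V * 'I_du, forall u k,
    H u ord0 k = \sum_(c : V * 'I_du) (c == s k)%:R * u c.1 ord0 c.2.

(* Density at [y] of the law N(H u, sigma^2 I) of H u + xi,
   xi ~ N(0, sigma^2 I), as a function of [u].  *)
Definition likelihood (R : realType) (U : Type) (d : nat) (H : U -> 'rV[R]_d)
    (sigma : R) (y : 'rV[R]_d) (u : U) : R :=
  gaussian_pdf (H u) (sigma ^+ 2)%:M y.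

Definition posterior d (X : measurableType d) (R : realType)
    (P : probability X R) (L : X -> R) : set X -> \bar R :=
  fun A => (\int[P]_(x in A) (L x)%:E / \int[P]_x (L x)%:E)%E.

(* Lebesgue density L(z) q(z) / p(y) of the posterior of the prior q = N(0, I),
   with p(y) the Lebesgue integral of L q.  *)
Definition latent_posterior_pdf (R : realType) (n : nat) (L : 'rV[R]_n -> R)
    (z : 'rV[R]_n) : R :=
  L z * gaussian_pdf 0 1%:M z /
  \int[lebesgue_rV R n]_x (L x * gaussian_pdf 0 1%:M (x : 'rV[R]_n)).

Definition latent_posterior (R : realType) (n : nat) (L : 'rV[R]_n -> R) :
    set (borel 'rV[R]_n) -> \bar R :=
  fun A => (\int[lebesgue_rV R n]_(z in A) (latent_posterior_pdf L z)%:E)%E.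

(* Main.v *)
(* Integrals against [D_# q] are integrals of the composition with [D] against
   [q], hence Lebesgue integrals of [(L \o D) * q]. Applied to [A] and to the
   whole space this matches numerators and evidences. The division by the
   evidence means the same on both sides because the likelihood is positive and
   bounded, so that the evidence is positive and finite. *)
Require Import Defs.
From mathcomp Require Import all_boot all_order all_algebra.
From mathcomp Require Import all_classical all_reals all_analysis.
From mathcomp Require Import measurable_realfun.

Set Implicit Arguments.
Unset Strict Implicit.
Unset Printing Implicit Defensive.

Import Order.TTheory GRing.Theory Num.Theory.
Import numFieldNormedType.Exports.

Local Open Scope classical_set_scope.
Local Open Scope ring_scope.

Section density.
Local Open Scope ereal_scope.
Context d (T : measurableType d) (R : realType).
Context (mu nu : {measure set T -> \bar R}) (g : T -> R).
Hypotheses (mg : measurable_fun setT g) (g0 : forall x, (0 <= g x)%R).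
Hypothesis (nuE : forall A, measurable A -> nu A = \int[mu]_(x in A) (g x)%:E).

Import HBNNSimple.

(** By linearity over the finitely many values [r] of [h], only the indicators of the level sets
    matter. For these, both sides are the integral of [g] over [E] cut with the level set, by
    [nuE]. *)
Let integral_density_nnsfun (E : set T) (h : {nnsfun T >-> R}) : measurable E ->
  \int[nu]_(x in E) (h x)%:E = \int[mu]_(x in E) ((h x)%:E * (g x)%:E).
Proof.
move=> mE; have mgE : measurable_fun E (EFin \o g).
  by apply/measurable_EFinP; exact: measurable_funTS.
have indich r : measurable_fun E (fun x => (r * \1_(h @^-1` [set r]) x)%:E).
  by apply: (measurable_comp measurableT) => //; exact: measurable_funM.
transitivity (\int[nu]_(x in E)
    (\sum_(y \in range h) (y * \1_(h @^-1` [set y]) x)%:E)).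
  by apply: eq_integral => t tE; rewrite /= fimfunE -fsumEFin.
rewrite ge0_integral_fsum//; last by move=> m y Ey; exact: nnfun_muleindic_ge0.
transitivity (\int[mu]_(x in E) (\sum_(y \in range h)
    (y * \1_(h @^-1` [set y]) x)%:E * (g x)%:E)); last first.
  apply: eq_integral => x xE.
  rewrite -ge0_mule_fsuml => [|y]; last exact: nnfun_muleindic_ge0.
  by rewrite fsumEFin // -(fimfunE _ x).
rewrite ge0_integral_fsum//; last 2 first.
- by move=> y; exact: emeasurable_funM.
- by move=> m y Ey; rewrite mule_ge0 ?nnfun_muleindic_ge0 ?lee_fin.
apply: eq_fsbigr => r rhn.
under eq_integral do rewrite EFinM.
rewrite integralZl_indic_nnsfun//.
under [RHS]eq_integral do rewrite EFinM -muleA.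
rewrite ge0_integralZl//.
- congr (_ * _); under [RHS]eq_integral do rewrite muleC.
  rewrite [RHS](eq_integral ((EFin \o g) \_ (h @^-1` [set r]))); last first.
    by move=> x xE; rewrite epatch_indic.
  by rewrite -integral_mkcondr integral_indic// nuE 1?setIC//; exact: measurableI.
- by apply: emeasurable_funM => //; exact/measurable_EFinP.
- by move=> t Et; rewrite mule_ge0 ?lee_fin.
- by move: rhn => /[!inE] -[x _ <-]; rewrite lee_fin.
Qed.

(** Approximation from below by simple functions: since [g] is nonnegative, the products with [g]
    still increase, and monotone convergence applies to both sides. *)
Lemma ge0_integral_density (E : set T) (f : T -> \bar R) :
  measurable E -> measurable_fun E f -> (forall x, E x -> 0 <= f x) ->
  \int[nu]_(x in E) f x = \int[mu]_(x in E) (f x * (g x)%:E).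
Proof.
move=> mE mf f0; pose h := nnsfun_approx mE mf.
have hf x : E x -> (h n x)%:E @[n --> \oo] --> f x.
  by move=> Ex; exact: cvg_nnsfun_approx.
have h_nd x : {homo (fun n => h n x) : m n / (m <= n)%N >-> (m <= n)%R}.
  by move=> m n mn; exact/lefP/nd_nnsfun_approx.
have mh n : measurable_fun E (EFin \o h n).
  by apply/measurable_EFinP; exact: measurable_funTS.
transitivity (limn (fun n => \int[nu]_(x in E) (h n x)%:E)).
  rewrite -monotone_convergence//.
  - by apply: eq_integral => x /[!inE] /hf h_cvg; exact/esym/cvg_lim.
  - by move=> n x _; rewrite lee_fin.
  - by move=> x _ m n mn; rewrite lee_fin h_nd.
under eq_fun do rewrite integral_density_nnsfun//.
rewrite -monotone_convergence//.
- apply: eq_integral => x /[!inE] Ex; apply/cvg_lim => //.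
  (* [g x] is finite, so multiplying by it preserves the limit even where [f x] is infinite. *)
  by apply: cvgeZr => //; exact: hf.
- move=> n; apply: emeasurable_funM; first exact: mh.
  by apply/measurable_EFinP; exact: measurable_funTS.
- by move=> n x _; rewrite mule_ge0 ?lee_fin.
- by move=> x _ m n mn; rewrite lee_wpmul2r ?lee_fin ?h_nd.
Qed.

End density.

(** A nonnegative function with zero integral vanishes almost everywhere, so a strictly positive one
    would force [D] to be null. *)
Lemma integral_gt0 d (T : measurableType d) (R : realType)
    (mu : {measure set T -> \bar R}) (D : set T) (f : T -> \bar R) :
  measurable D -> (0 < mu D)%E -> measurable_fun D f ->
  (forall x, D x -> 0 < f x)%E -> (0 < \int[mu]_(x in D) f x)%E.
Proof.
move=> mD muD mf f0; rewrite lt_neqAle integral_ge0 ?andbT; last first.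
  by move=> x /f0/ltW.
apply/eqP => /esym f_eq0; suff : mu D = 0%E.
  by move=> muD0; rewrite muD0 ltxx in muD.
have /(ae_eq_integral_abs mu mD mf) : (\int[mu]_(x in D) `|f x| = 0)%E.
  rewrite -[RHS]f_eq0; apply: eq_integral => x /[!inE] Dx.
  by rewrite gee0_abs// ltW// f0.
move=> fD; apply/negligibleP => //; apply: negligibleS fD => x Dx /= /(_ Dx) fx0.
by have := f0 _ Dx; rewrite fx0 ltxx.
Qed.

Section likelihood.
Context (R : realType) (U : Type) (d : nat) (H : U -> 'rV[R]_d).
Context (sigma : R) (y : 'rV[R]_d).

(** The covariance is a scalar matrix, so its determinant is a power and the quadratic form reduces
    to a squared distance. Sign, bound and measurability are all read off this form. *)
Lemma likelihoodE u : likelihood H sigma y u =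
  (Num.sqrt ((2 * pi) ^+ d * (sigma ^+ 2) ^+ d))^-1 *
  expR (- (sigma ^- 2 * \sum_(k < d) (y ord0 k - H u ord0 k) ^+ 2) / 2).
Proof.
rewrite /likelihood /gaussian_pdf det_scalar invmx_scalar mul_mx_scalar.
rewrite -scalemxAl mxE; set q := (_ *m _) _ _.
suff -> : q = \sum_(k < d) (y ord0 k - H u ord0 k) ^+ 2 by [].
by rewrite /q mxE; apply: eq_bigr => k _; rewrite !mxE expr2.
Qed.

Hypothesis sigma_gt0 : 0 < sigma.

Let peak_gt0 : 0 < (Num.sqrt ((2 * pi) ^+ d * (sigma ^+ 2) ^+ d))^-1.
Proof.
by rewrite invr_gt0 sqrtr_gt0 mulr_gt0// !exprn_gt0// ?mulr_gt0// pi_gt0.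
Qed.

Lemma likelihood_gt0 u : 0 < likelihood H sigma y u.
Proof. by rewrite likelihoodE mulr_gt0// expR_gt0. Qed.

(** The exponent is nonpositive, so the peak factor is a bound uniform in [u]; it makes the evidence
    finite. *)
Lemma likelihood_le u : likelihood H sigma y u <=
  (Num.sqrt ((2 * pi) ^+ d * (sigma ^+ 2) ^+ d))^-1.
Proof.
rewrite likelihoodE ler_piMr ?(ltW peak_gt0)//.
rewrite -expR0 ler_expR mulNr oppr_le0 mulr_ge0 ?invr_ge0//.
rewrite mulr_ge0 ?invr_ge0 ?sqr_ge0//.
by apply: sumr_ge0 => k _; exact: sqr_ge0.
Qed.

End likelihood.

Lemma measurable_likelihood dT (T : measurableType dT) (R : realType) (d : nat)
    (H : T -> 'rV[R]_d) (sigma : R) (y : 'rV[R]_d) :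
  (forall k, measurable_fun setT (fun u => H u ord0 k)) ->
  measurable_fun setT (likelihood H sigma y).
Proof.
move=> mH; rewrite (funext (likelihoodE H sigma y)).
apply: measurable_funM => //; apply: measurableT_comp => //.
apply: measurable_funM => //; apply: measurableT_comp => //.
apply: measurable_funM => //; apply: measurable_sum => k.
by apply: measurable_funX; apply: measurable_funB.
Qed.

(* [borel_continuousR] does not apply to [{ptws V -> 'rV[R]_du}], which has no
   [ptopologicalType] instance. *)
Lemma measurable_preimage_open (R : realType) (S : pointedType)
    (G : set (set S)) (f : S -> R) :
  (forall B, open B -> G (f @^-1` B)) ->
  measurable_fun setT (f : g_sigma_algebraType G -> R).
Proof.
move=> Gf.
apply: (measurability _ (RGenOpens.measurableE R)) => _ [_ [a [b ->] <-]].
by rewrite setTI; apply: sub_sigma_algebra; apply: Gf; exact: interval_open.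
Qed.

(** An observed component is a finite combination of scalar coordinates of [u], each continuous for
    pointwise convergence as evaluation at a vertex followed by a coordinate projection. *)
Lemma measurable_selection (R : realType) (V : finType) (du d : nat)
    (H : (V -> 'rV[R]_du) -> 'rV[R]_d) : selection_operator H ->
  forall k, measurable_fun setT
    (fun u : borel {ptws V -> 'rV[R]_du} => H u ord0 k).
Proof.
move=> [s HE] k.
rewrite (_ : (fun _ => _) = fun u : borel {ptws V -> 'rV[R]_du} =>
    \sum_(c : V * 'I_du) (c == s k)%:R * (u : V -> 'rV_du) c.1 ord0 c.2); last first.
  by apply/funext => u; exact: HE.
apply: measurable_sum => c; apply: measurable_funM => //.
apply: measurable_preimage_open => B oB.
have /continuousP : continuous (fun u : {ptws V -> 'rV[R]_du} => u c.1 ord0 c.2).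
  move=> u; apply: (@continuous_comp _ _ _
    (fun u : {ptws V -> 'rV[R]_du} => u c.1) (fun v : 'rV[R]_du => v ord0 c.2)).
    exact: (@proj_continuous V (fun=> 'rV[R]_du) c.1).
  exact: coord_continuous.
exact.
Qed.

Theorem theorem2p2 (R : realType) (Vo : finType) (du dz d_o : nat)
    (D : {mfun borel 'rV[R]_dz >-> borel {ptws Vo -> 'rV[R]_du}})
    (H : {linear (Vo -> 'rV[R]_du) -> 'rV[R]_d_o})
    (hH : selection_operator H)
    (sigma : R) (sigma_gt0 : 0 < sigma) (y : 'rV[R]_d_o)
    (A : set (borel {ptws Vo -> 'rV[R]_du})) (mA : measurable A) :
  posterior (distribution (std_gaussian R dz) D) (likelihood H sigma y) A =
  pushforward (latent_posterior (fun z => likelihood H sigma y (D z))) D A.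
Proof.
set L := likelihood H sigma y.
have mL : measurable_fun setT (L : borel {ptws Vo -> 'rV[R]_du} -> R).
  apply: measurable_likelihood; exact: measurable_selection.
have L_gt0 u : 0 < L u by exact: likelihood_gt0.
have mLD : measurable_fun setT (fun z => L (D z)) by exact: measurableT_comp.
have mq := @measurable_gaussian_pdf01 R dz.
(* The latent posterior density before normalization. *)
pose Lq := fun z : borel 'rV[R]_dz =>
  (L (D z) * gaussian_pdf 0 1%:M (z : 'rV[R]_dz))%:E.
have mLq : measurable_fun setT Lq.
  by apply/measurable_EFinP; exact: measurable_funM.
have Lq_ge0 z : (0 <= Lq z)%E.
  by rewrite lee_fin mulr_ge0 ?gaussian_pdf01_ge0// ltW.
have mD B : measurable B -> measurable (D @^-1` B).
  by move=> mB; rewrite -[X in measurable X]setTI; exact: measurable_funPT.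
have evidenceE B : measurable B ->
    (\int[distribution (std_gaussian R dz) D]_(u in B) (L u)%:E =
     \int[lebesgue_rV R dz]_(z in D @^-1` B) Lq z)%E.
  move=> mB; have mDB := mD _ mB.
  rewrite ge0_integral_pushforward//; last 2 first.
  - by apply/measurable_EFinP; exact: measurable_funTS.
  - by move=> u _; rewrite lee_fin ltW.
  (* The hypothesis [nuE] holds here by the very definition of [std_gaussian]. *)
  rewrite (@ge0_integral_density _ _ _ (lebesgue_rV R dz) _
    (gaussian_pdf 0 1%:M))//.
  - exact: gaussian_pdf01_ge0.
  - by apply/measurable_EFinP; exact: measurable_funTS.
  - by move=> z _; rewrite lee_fin ltW.
rewrite /posterior /pushforward /latent_posterior /latent_posterior_pdf.
have := evidenceE _ measurableT; rewrite preimage_setT => ZE.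
set Z := (\int[distribution _ _]_u _)%E.
have Z_gt0 : (0 < Z)%E.
  apply: integral_gt0 => //.
  - by rewrite [ltRHS](@probability_setT _ _ _ (distribution (std_gaussian R dz) D)).
  - exact/measurable_EFinP.
  - by move=> u _; rewrite lte_fin.
have Z_fin : Z \is a fin_num.
  rewrite ge0_fin_numE ?(ltW Z_gt0)//.
  apply: (@le_lt_trans _ _ (\int[distribution (std_gaussian R dz) D]_u
      (Num.sqrt ((2 * pi) ^+ d_o * (sigma ^+ 2) ^+ d_o))^-1%:E)%E).
    apply: ge0_le_integral => //.
    - by move=> u _; rewrite lee_fin ltW.
    - exact/measurable_EFinP.
    - by move=> u _; rewrite lee_fin likelihood_le.
  by rewrite integral_cst//= probability_setT mule1 ltry.
rewrite evidenceE//.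
(* The extended inverse treats 0 as a special case: [Z_gt0] excludes it, and [Z_fin] lets [Z] be
   replaced by a real number. *)
have -> : (Z^-1 = ((fine Z)^-1)%:E)%E.
  rewrite -[in LHS](fineK Z_fin) inver gt_eqF// fine_gt0//.
  by rewrite Z_gt0 ltey_eq Z_fin.
(* [latent_posterior_pdf] divides under the integral sign, so the constant is moved inside. *)
have mDA := mD _ mA; rewrite -ge0_integralZr//; last 2 first.
- exact: measurable_funTS.
- by rewrite lee_fin invr_ge0 fine_ge0// ltW.
(* The real-valued normalizing constant is by definition [fine] of the extended integral of [Lq],
   which [ZE] identifies with [fine Z]. *)
by apply: eq_integral => z _; rewrite /Rintegral /Z ZE.
Qed.
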